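(* For every prime $p$ and all integers $n\ge 0$, $r,s,\ell,k\ge 1$ and $j$ with $1\le j<p$, we have \[\bar{b}^{p^k\ell}_{r,s}(p^kn+p^{k-1}j)\equiv 0\pmod{p}.\]
   Context: Write $f_m=\prod_{i\ge 1}(1-q^{mi})$ for $m\ge 1$, and $f_m^a$ for its $a$-th power. For integers $r,s,k\ge 1$, $\bar{b}^k_{r,s}(n)$ denotes the number of overcolored partition $k$-tuples of $n$: $k$-tuples of partitions of total weight $n$ in which each even part may appear in one of $r$ colors, each odd part may appear in one of $s$ colors, and the first occurrence of each part (of each color) in each component may be overlined. Equivalently, as formal power series in $q$, \[\sum_{n=0}^{\infty}\bar{b}^k_{r,s}(n)q^n=\frac{f_2^{(3s-2r)k}}{f_1^{2sk}f_4^{(s-r)k}}.\] (The superscript is the number of components of the tuple, not a power.) *)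

(* Defs.v *)
From mathcomp Require Import all_boot.

Set Implicit Arguments.
Unset Strict Implicit.
Unset Printing Implicit Defensive.

(* Number of colors available for a part of size m. *)
Definition ncolors (r s m : nat) : nat := if odd m then s else r.

(* Colored parts of size at most N.  The index i : 'I_N stands for the part
   size i.+1, so that part sizes range over 1, ..., N. *)
Definition colored_part (r s N : nat) : finType :=
  {i : 'I_N & 'I_(ncolors r s i.+1)}.

Definition part_size (r s N : nat) (c : colored_part r s N) : nat :=
  (tag c).+1.

(* An overcolored partition is given by the multiplicity of each colored part
   together with the set of colored parts whose first occurrence is overlined;
   only a part which does occur can be overlined.  Parts and multiplicities are
   bounded by N in order to get a finite type; since parts are positive, this
   loses nothing for partitions of weight at most N. *)
Definition overcolored_partition (r s N : nat) : finType :=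
  {x : {ffun colored_part r s N -> 'I_N.+1} * {set colored_part r s N}
     | [forall c in x.2, 0 < x.1 c]}.

Definition weight (r s N : nat) (x : overcolored_partition r s N) : nat :=
  \sum_(c : colored_part r s N) (val x).1 c * part_size c.

(* The number of overcolored partition k-tuples of total weight n; the bound n
   on the parts and multiplicities of each component is then not a
   restriction. *)
Definition bbar (k r s n : nat) : nat :=
  #|[set t : k.-tuple (overcolored_partition r s n)
       | \sum_(i < k) weight (tnth t i) == n]|.

(* Main.v *)
Require Import Defs.
From mathcomp Require Import all_boot.
From mathcomp Require Import fingroup perm action pgroup cyclic sylow.

(** The cyclic group of order [p ^ k] acts on [p ^ k * l]-tuples by rotating
    them by [l] positions, and this preserves the total weight.  A fixed tuple
    consists of [p ^ k] copies of one block, so its weight is a multiple of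
    [p ^ k], which [p ^ k * n + p ^ k.-1 * j] is not.  A [p]-group acting
    without fixed points forces the cardinality to be divisible by [p]. *)

(** Commutation makes [u] a prefix of [v], and what is left after removing it still commutes with
    [u]; by induction [v] is [m] copies of [u]. *)
Lemma sum_commuting_cat (T : Type) (f : T -> nat) (m : nat) (u v : seq T) :
  u ++ v = v ++ u -> size v = m * size u ->
  \sum_(x <- v) f x = m * \sum_(x <- u) f x.
Proof.
elim: m v => [|m IHm] v uvC sz_v.
  by rewrite (size0nil sz_v) big_nil.
have le_uv : size u <= size v by rewrite sz_v mulSn leq_addr.
have def_v : v = u ++ drop (size u) v.
  rewrite -{1}(cat_take_drop (size u) v); congr (_ ++ _).
  by rewrite -(takel_cat u le_uv) -uvC take_size_cat.
move: (drop _ _) def_v => w def_v; rewrite {}def_v {v le_uv} in uvC sz_v *.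
have uwC : u ++ w = w ++ u.
  move: uvC; rewrite -catA => /(congr1 (drop (size u))).
  by rewrite !drop_size_cat.
rewrite big_cat /= mulSn (IHm w) //.
by move: sz_v; rewrite size_cat mulSn => /addnI.
Qed.

(** Invariance under [rot l] says exactly that the first block [take l s] commutes with the rest. *)
Lemma dvdn_sum_rot_fixed (T : Type) (f : T -> nat) (m l : nat) (s : seq T) :
  size s = m * l -> rot l s = s -> m %| \sum_(x <- s) f x.
Proof.
case: m => [|m] sz_s rot_s; first by rewrite (size0nil sz_s) big_nil.
have sz_take : size (take l s) = l.
  by rewrite size_takel // sz_s mulSn leq_addr.
have comm : take l s ++ drop l s = drop l s ++ take l s.
  by rewrite cat_take_drop -[LHS]rot_s.
rewrite -(cat_take_drop l s) big_cat /=.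
rewrite (@sum_commuting_cat _ f m _ _ comm); first by rewrite -mulSn dvdn_mulr.
by rewrite sz_take size_drop sz_s mulSn addKn.
Qed.

(** The bound matters because [rot] past the length is the identity and does not wrap around. *)
Lemma iter_rot (T : Type) (m l : nat) (s : seq T) :
  m * l <= size s -> iter m (rot l) s = rot (m * l) s.
Proof.
elim: m => [|m IHm] le_s; first by rewrite rot0.
by rewrite iterS IHm ?mulSn ?rotD // (leq_trans _ le_s) // mulSn leq_addl.
Qed.

Lemma dvdn_card_weighted_tuples (T : finType) (f : T -> nat) (p k l w : nat) :
  prime p -> ~~ (p ^ k %| w) ->
  p %| #|[set t : (p ^ k * l).-tuple T | \sum_i f (tnth t i) == w]|.
Proof.
move=> p_pr p_ndv_w; set S := [set t | _].
have inS t : (t \in S) = (\sum_(x <- t) f x == w) by rewrite inE [in RHS]big_tuple.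
have rot_inj : injective (fun t : (p ^ k * l).-tuple T => [tuple of rot l t]).
  by move=> t u /(congr1 val) /= /rot_inj tu; apply: val_inj.
pose g := perm rot_inj.
have gE t : val (g t) = rot l t by rewrite permE.
have gX n t : val ((g ^+ n)%g t) = iter n (rot l) t.
  by elim: n => [|n IHn]; rewrite ?expg0 ?perm1 // expgSr permM gE IHn.
(* After [p ^ k] rotations by [l] the tuple has made one full turn, so the order of [g] divides
   [p ^ k]. *)
have pG : (p.-group <[g]>)%g.
  have g_ord : (g ^+ (p ^ k) = 1)%g.
    apply/permP=> t; apply: val_inj.
    by rewrite gX perm1 iter_rot ?size_tuple // -{1}(size_tuple t) rot_size.
  by apply: (@pnat_dvd _ (p ^ k)); rewrite ?pnatX ?pnat_id // order_dvdn g_ord.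
have actS : [acts <[g]>, on S | 'P]%g.
  rewrite cycle_subG !inE; apply/subsetP=> t; rewrite inS inE /=.
  by rewrite inS /aperm gE (perm_big _ (permEl (perm_rot l t))).
(* Orbits of a [p]-group that are not fixed points have size divisible by [p]. *)
rewrite /dvdn (pgroup_fix_mod pG actS) -/(dvdn p _).
suff -> : ('Fix_(S | 'P)(<[g]>))%g = set0 by rewrite cards0 dvdn0.
apply/setP=> t; rewrite [in RHS]inE; apply/negP=> /setIP[tS /afixP fix_t].
have rot_t : rot l t = t.
  by rewrite -gE; congr val; apply: (fix_t g); apply: cycle_id.
case/negP: p_ndv_w; move: tS; rewrite inS => /eqP <-.
by apply: (@dvdn_sum_rot_fixed _ _ _ l); rewrite ?size_tuple.
Qed.

Theorem theorem1p9 (p : nat) (hp : prime p) (n r s l k j : nat)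
    (hr : 1 <= r) (hs : 1 <= s) (hl : 1 <= l) (hk : 1 <= k)
    (hj1 : 1 <= j) (hjp : j < p) :
  bbar (p ^ k * l) r s (p ^ k * n + p ^ k.-1 * j) = 0 %[mod p].
Proof.
apply/eqP; rewrite mod0n; apply: dvdn_card_weighted_tuples => //.
(* Only [p ^ k.-1 * j] matters modulo [p ^ k]; cancelling [p ^ k.-1] leaves [p %| j], impossible for
   [0 < j < p]. *)
rewrite (dvdn_addr _ (dvdn_mulr n (dvdnn _))).
case: k hk => // k _ /=.
by rewrite expnSr dvdn_pmul2l ?expn_gt0 ?prime_gt0 // gtnNdvd.
Qed.
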